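(* Let $u,v\geq 2$ be integers and let $M=\begin{bmatrix} a & b\\ c & d\end{bmatrix}\in\mathscr{S}_{u,v}$. Then $C(c/a)$ satisfies the $(v,u)$-divisibility property if and only if $C(b/d)$ satisfies the $(u,v)$-divisibility property.
   Context: $\mathbb{N}$ denotes the set of nonnegative integers and $SL_2(\mathbb{N})$ the set of $2\times 2$ matrices with entries in $\mathbb{N}$ and determinant $1$. Let $$\mathscr{S}_{u,v}=\left\{\begin{bmatrix}1+uvn_1 & vn_2\\ un_3 & 1+uvn_4\end{bmatrix}\in SL_2(\mathbb{N}) : (n_1,n_2,n_3,n_4)\in\mathbb{N}^4\right\}.$$ For integers $q_0,\dots,q_r$, $[q_0,q_1,\dots,q_r]$ denotes the (possibly undefined) continued fraction $q_0+\cfrac{1}{q_1+\cfrac{1}{\ddots+\cfrac{1}{q_r}}}$. Every rational $x$ has a unique representation $x=[x_0,\dots,x_r]$ with all $x_i\in\mathbb{Z}$, $x_i\geq 1$ for $0<i<r$, and $x_r>1$ when $r>0$; this is the short continued fraction representation of $x$. Finite sequences of integers are written $\llbracket q_0,\dots,q_r\rrbracket$, and $C(x):=\llbracket x_0,\dots,x_r\rrbracket$ where $[x_0,\dots,x_r]$ is the short continued fraction representation of $x$. For positive integers $s,t$, a sequence $\llbracket q_0,\dots,q_r\rrbracket$ satisfies the $(s,t)$-divisibility property if $t\mid q_i$ for every even index $i$ and $s\mid q_i$ for every odd index $i$ ($0\leq i\leq r$). *)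

(* Defs.v *)
From mathcomp Require Import all_boot all_order all_algebra.
Set Implicit Arguments.
Unset Strict Implicit.
Unset Printing Implicit Defensive.
Import Order.TTheory GRing.Theory Num.Theory.
Local Open Scope ring_scope.

Definition mx2 (T : Type) (a b c d : T) : 'M[T]_2 :=
  \matrix_(i, j) if i == 0 then (if j == 0 then a else b)
                 else (if j == 0 then c else d).

(* The determinant is taken over [int], since [nat] has no subtraction. *)
Definition SL2N (M : 'M[nat]_2) : Prop := \det (map_mx Posz M) = 1.

Definition scrS (u v : nat) (M : 'M[nat]_2) : Prop :=
  SL2N M /\
  exists n1 n2 n3 n4 : nat,
    M = mx2 (1 + u * v * n1)%N (v * n2)%N (u * n3)%N (1 + u * v * n4)%N.

(* [None] means undefined: a denominator that vanishes, at any depth, makes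
   the whole continued fraction undefined, and so does the empty sequence. *)
Fixpoint cfrac (q : seq int) : option rat :=
  match q with
  | [::] => None
  | [:: z] => Some z%:~R
  | z :: q' =>
      if cfrac q' is Some y then
        if y == 0 then None else Some (z%:~R + y^-1)
      else None
  end.

(* With q = [q_0, ..., q_r], the index r is [(size q).-1]. *)
Definition is_short (q : seq int) : bool :=
  [forall i : 'I_(size q), (0 < i < (size q).-1)%N ==> (1 <= q`_i)] &&
  ((0 < (size q).-1)%N ==> (1 < q`_(size q).-1)).

Definition short_cfrac_of (x : rat) (q : seq int) : bool :=
  is_short q && (cfrac q == Some x).

Lemma is_shortE (q : seq int) :
  is_short q = all (fun z => 1 <= z) (behead q)
               && ((1 < size q)%N ==> (1 < last 0 q)).
Proof.
rewrite /is_short nth_last; case: q => [|z q] /=.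
  by rewrite andbT; apply/forallP; case.
case: q => [|w q] /=.
  by rewrite !andbT; apply/forallP => i; apply/implyP; rewrite andbC.
set l := last w q; have [l1|_] := boolP (1 < l); last by rewrite !andbF.
rewrite !andbT -[(1 <= w) && _]/(all (fun z => 1 <= z) (w :: q)).
apply/forallP/(all_nthP 0) => [H i|H i].
  move=> ilt; case: (ltnP i (size q)) => [iq|qi].
    have hi : (i.+1 < (size q).+2)%N by rewrite !ltnS ltnW.
    by have /implyP := H (Ordinal hi); apply; rewrite /= ltnS.
  have -> : i = (size q) by apply/eqP; rewrite eqn_leq qi andbT -ltnS.
  by rewrite -[size q]/((size (w :: q)).-1) nth_last /= ltW.
apply/implyP; case: i => -[|i] //= _ iq.
by apply: H; rewrite /= ltnS ltnW.
Qed.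

Lemma cfrac_tail (q : seq int) :
  q != [::] -> all (fun z => 1 <= z) q -> 1 < last 0 q ->
  exists2 y, cfrac q = Some y & 1 < y.
Proof.
elim: q => [//|z [|w q] IH] _.
  by move=> _ /= z1; exists z%:~R; rewrite ?ltr1z.
case/andP=> z1 qa ql; have [//|//|//|y qy y1] := IH.
rewrite -[cfrac _]/(if cfrac (w :: q) is Some y then _ else _) qy.
have y0 : 0 < y by apply: lt_trans y1.
rewrite gt_eqF //; eexists; first by [].
by rewrite -[1]addr0 ler_ltD ?invr_gt0 // ler1z.
Qed.

Lemma cfrac_cons (z : int) (q : seq int) :
  q != [::] -> is_short (z :: q) ->
  is_short q /\
  exists2 y, cfrac q = Some y & 1 < y /\ cfrac (z :: q) = Some (z%:~R + y^-1).
Proof.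
case: q => [//|w q] _; rewrite !is_shortE => /andP[qa ql].
have [y qy y1] := @cfrac_tail (w :: q) isT qa ql; split.
  by case/andP: qa => _ qa; apply/andP; split=> //; apply/implyP.
exists y => //; split=> //.
rewrite -[LHS]/(if cfrac (w :: q) is Some y then _ else _) qy.
by rewrite gt_eqF // (lt_trans _ y1).
Qed.

Lemma floor_eq (z z' : int) (e e' : rat) :
  0 <= e < 1 -> 0 <= e' < 1 -> z%:~R + e = z'%:~R + e' -> z = z' /\ e = e'.
Proof.
move=> /andP[e0 e1] /andP[f0 f1] E.
suff zz : z = z' by split=> //; move: E; rewrite zz => /addrI.
apply/eqP; rewrite eq_le -!ltzD1 -!(ltr_int rat) !intrD; apply/andP; split.
  by apply: (@le_lt_trans _ _ (z%:~R + e)); rewrite ?lerDl // E ltrD2l.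
by apply: (@le_lt_trans _ _ (z'%:~R + e')); rewrite ?lerDl // -E ltrD2l.
Qed.

Lemma short_cfrac_uniq (x : rat) (q q' : seq int) :
  short_cfrac_of x q -> short_cfrac_of x q' -> q = q'.
Proof.
have inv1 y : 1 < y :> rat -> 0 <= y^-1 < 1.
  move=> y1; have y0 : 0 < y by apply: lt_trans y1.
  by rewrite invr_ge0 ltW // invf_lt1.
have invN0 y : 1 < y :> rat -> y^-1 <> 0.
  by move=> y1 /eqP; rewrite invr_eq0 gt_eqF // (lt_trans _ y1).
elim: q x q' => [|z q IH] x [|z' q'] /andP[sq /eqP qx] /andP[sq' /eqP qx'] //.
have [q0|qN] := eqVneq q [::]; have [q0'|qN'] := eqVneq q' [::]; subst.
- by move: qx qx' => /= [<-] [/intr_inj ->].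
- have [_ [y _ [y1 E]]] := cfrac_cons qN' sq'; move: qx' qx; rewrite E /=.
  move=> [<-] [/esym]; rewrite -[z%:~R]addr0.
  by move/(floor_eq (inv1 _ y1)) => [//|_ /(invN0 _ y1)].
- have [_ [y _ [y1 E]]] := cfrac_cons qN sq; move: qx qx'; rewrite E /=.
  move=> [<-] [/esym]; rewrite -[z'%:~R]addr0.
  by move/(floor_eq (inv1 _ y1)) => [//|_ /(invN0 _ y1)].
- have [s [y qy [y1 E]]] := cfrac_cons qN sq.
  have [s' [y' qy' [y1' E']]] := cfrac_cons qN' sq'.
  move: qx qx'; rewrite E E' => -[<-] [/esym].
  move/(floor_eq (inv1 _ y1) (inv1 _ y1')) => [-> /invr_inj yy].
  by congr cons; apply: (IH y); rewrite /short_cfrac_of ?s ?s' ?qy ?qy' -?yy /=.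
Qed.

Lemma short_cfrac_cons (z : int) (q : seq int) (y : rat) :
  1 < y -> short_cfrac_of y q -> short_cfrac_of (z%:~R + y^-1) (z :: q).
Proof.
case: q => [|w q] y1 /andP[sq /eqP qy]; first by [].
have yN0 : y != 0 by rewrite gt_eqF // (lt_trans _ y1).
apply/andP; split; last first.
  by rewrite -[cfrac _]/(if cfrac (w :: q) is Some y then _ else _) qy ifN.
have [w1 wq] : 1 <= w /\ (q = [::] -> 1 < w).
  have [q0|qN] := eqVneq q [::].
    by move: qy y1; rewrite q0 /= => -[<-]; rewrite ltr1z => w1; split=> //; rewrite ltW.
  have [_ [y' _ [y1' E]]] := cfrac_cons qN sq; split; last by move=> q0; rewrite q0 in qN.
  move: qy y1; rewrite E => -[<-] lt1.
  rewrite -gtz0_ge1 -(ltr0z rat) -(ltrD2r y'^-1) add0r (lt_trans _ lt1) //.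
  by rewrite invf_lt1 // (lt_trans _ y1').
move: sq; rewrite !is_shortE /= => /andP[-> ql]; rewrite w1 /=.
by case: q wq ql {qy} => [|? ?] /= wq ql //; rewrite wq.
Qed.

Lemma short_cfrac_exists (x : rat) : exists q, short_cfrac_of x q.
Proof.
suff H (n : nat) (m : int) : (0 < n)%N ->
    exists q, short_cfrac_of (m%:~R / n%:~R) q.
  by rewrite -(divq_num_den x) -(gez0_abs (ltW (denq_gt0 x))); apply: H;
    rewrite absz_gt0 denq_neq0.
elim/ltn_ind: n m => n IH m n0.
have nN0 : n%:Z != 0 by case: (n) n0.
have nQ : (n%:Z)%:~R != 0 :> rat by rewrite intr_eq0.
have [r rE] : exists r : nat, (m %% n)%Z = r.
  by exists `|(m %% n)%Z|%N; rewrite gez0_abs // modz_ge0.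
have rn : (r < n)%N by rewrite -ltz_nat -rE ltz_pmod.
have -> : m%:~R / n%:~R = (m %/ n)%Z%:~R + r%:~R / n%:~R :> rat.
  by rewrite {1}(divz_eq m n) rE intrD intrM mulrDl mulfK.
have [r0|r0] := posnP r.
  exists [:: (m %/ n)%Z]; rewrite r0 mul0r addr0 /short_cfrac_of is_shortE /=.
  by rewrite eqxx.
have [q qP] := IH r rn n%:Z r0.
exists ((m %/ n)%Z :: q); rewrite -[_ / _]invf_div; apply: short_cfrac_cons => //.
by rewrite ltr_pdivlMr ?mul1r ?ltr_int ?ltz_nat // ltr0z.
Qed.

Definition C (x : rat) : seq int := xchoose (short_cfrac_exists x).

Lemma C_short (x : rat) : short_cfrac_of x (C x).
Proof. exact: xchooseP. Qed.

Definition divisibility_property (s t : nat) (q : seq int) : Prop :=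
  forall i : nat, (i < size q)%N ->
    (~~ odd i -> (t%:Z %| q`_i)%Z) /\ (odd i -> (s%:Z %| q`_i)%Z).

(* Main.v *)
Require Import Defs.
From mathcomp Require Import all_boot all_order all_algebra.
From mathcomp Require Import zify ring.
Import Order.TTheory GRing.Theory Num.Theory.
Local Open Scope ring_scope.

(** Write K(q) for the product of the matrices [[z, 1], [1, 0]] over the entries
z of q.  When q = C(c/a), its first column is (c, a), because both fractions are
reduced with a positive denominator, and its second column (d0, b0) is the
previous convergent.

Suppose that u divides the entries of even index and v those of odd index.
Modulo v every other factor of K(q) is the exchange matrix, so the entries of
the bottom row are 0 and 1 modulo v, in an order given by the parity of the
length of q ([cfcol_mod]).  As a is 1 modulo v and v > 1, the length is odd.
Hence (c, a), (d0, b0) has the same determinant -1 as (c, a), (d, b), which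
forces (d, b) = k (c, a) + (d0, b0) for an integer k.  Since b and b0 vanish
modulo v and a is 1, v divides k; since 0 <= b0 < a and b >= 0, k >= 0.

If k > 0, (d, b) is the first column of K(q, k); if k = 0, it is the first
column of K of q without its last entry.  In both cases d/b is the value of a
sequence of even length with the same divisibilities, and b/d is the value of
that sequence with a 0 put in front, or with its first entry removed if that
is 0 already.  Either way the index of each entry moves by one, which exchanges
u and v ([alternates_C_of_cfcol]).  The last entry is a positive multiple of v,
hence greater than 1, so the new sequence is the short one, C(b/d).  The even
length may be 0: then (d, b) = (1, 0), and C(0) consists of a single 0.

The converse is the same implication for the matrix with rows (d, c), (b, a)
and with u and v exchanged. *)

(** The matrix K(q) applied to the column p; the two columns of K(q) are the
values at (1, 0) and (0, 1). *)
Definition cfcol (q : seq int) (p : int * int) : int * int :=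
  foldr (fun z p => (z * p.1 + p.2, p.1)) p q.

Lemma cfcol_cons (z : int) (q : seq int) (p : int * int) :
  cfcol (z :: q) p = (z * (cfcol q p).1 + (cfcol q p).2, (cfcol q p).1).
Proof. by []. Qed.

Lemma cfcol_rcons (q : seq int) (z : int) (p : int * int) :
  cfcol (rcons q z) p = cfcol q (z * p.1 + p.2, p.1).
Proof. exact: foldr_rcons. Qed.

Fixpoint alternates (s t : nat) (q : seq int) : bool :=
  if q is z :: q' then (t%:Z %| z)%Z && alternates t s q' else true.

Lemma divisibility_propertyE (s t : nat) (q : seq int) :
  divisibility_property s t q <-> alternates s t q.
Proof.
elim: q s t => [|z q IH] s t; first by split.
split=> [H|/= /andP[tz /IH H] [|i] //= /H[Hs Ht]].
  have [tz _] := H 0 isT; rewrite /= tz //=.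
  apply/IH => i iq; have [He Ho] := H i.+1 iq.
  by split=> [/Ho|] //; move: He; rewrite /= negbK.
by split=> // /negPn /Ht.
Qed.

Lemma alternates_rcons (s t : nat) (q : seq int) (k : int) :
  alternates s t (rcons q k) =
  alternates s t q && ((if odd (size q) then s else t)%:Z %| k)%Z.
Proof.
elim: q s t => [|z q IH] s t /=; first by rewrite andbT.
by rewrite IH andbA; case: (odd _).
Qed.

Lemma cfcol_linear (q : seq int) (k x y x' y' : int) :
  cfcol q (k * x + x', k * y + y') =
  (k * (cfcol q (x, y)).1 + (cfcol q (x', y')).1,
   k * (cfcol q (x, y)).2 + (cfcol q (x', y')).2).
Proof. by elim: q => [|z q /= ->] //=; congr pair; ring. Qed.

(** Each factor [[z, 1], [1, 0]] of K(q) has determinant -1. *)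
Lemma cfcol_det (q : seq int) (p p' : int * int) :
  (cfcol q p).1 * (cfcol q p').2 - (cfcol q p).2 * (cfcol q p').1 =
  (-1) ^+ size q * (p.1 * p'.2 - p.2 * p'.1).
Proof.
elim: q => [|z q IH] /=; first by rewrite expr0 mul1r.
by rewrite exprS -mulrA -IH; ring.
Qed.

(** A product of two consecutive factors [[z, 1], [1, 0]] [[w, 1], [1, 0]] is
lower unitriangular modulo a divisor of z and upper unitriangular modulo a
divisor of w.  So modulo t the top row of K(q), and modulo s its bottom row,
is that of the identity or of the exchange matrix, according to the parity of
the length of q. *)
Lemma cfcol_mod (s t : nat) (q : seq int) (p : int * int) :
  alternates s t q ->
  (t %| (cfcol q p).1 - (if odd (size q) then p.2 else p.1))%Z &&
  (s %| (cfcol q p).2 - (if odd (size q) then p.1 else p.2))%Z.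
Proof.
elim: q s t => [|z q IH] s t /=; first by rewrite !subrr !dvdz0.
case/andP=> tz /IH; case: (odd _) => /= /andP[-> ty]; rewrite andbT -addrA;
  by rewrite rpredD // dvdz_mulr.
Qed.

Lemma cfrac_cfcol (q : seq int) : q != [::] -> is_short q ->
  0 < (cfcol q (1, 0)).2 /\
  cfrac q = Some ((cfcol q (1, 0)).1%:~R / (cfcol q (1, 0)).2%:~R).
Proof.
elim: q => [//|z [|w q] IH] _ qs.
  by rewrite /= mulr1 addr0 divr1.
have [ws [y wy [y1 ->]]] := @cfrac_cons z (w :: q) isT qs.
have [Y0 E] := IH isT ws; move: wy y1; rewrite {}E => /Some_inj <-.
move: Y0; rewrite (cfcol_cons z).
case: (cfcol (w :: q) _) => X Y /= Y0; have YQ : 0 < Y%:~R :> rat by rewrite ltr0z.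
rewrite ltr_pdivlMr // mul1r ltr_int => YX; have X0 : 0 < X by apply: lt_trans YX.
split=> //; have XQ : 0 < X%:~R :> rat by rewrite ltr0z.
by congr Some; rewrite invf_div intrD intrM mulrDl mulfK // gt_eqF.
Qed.

Lemma C_eq (x : rat) (q : seq int) : short_cfrac_of x q -> C x = q.
Proof. exact: short_cfrac_uniq (C_short x). Qed.

(** Being a column of a matrix of determinant 1 or -1 is the form in which
coprimality is at hand for both fractions to be compared. *)
Lemma reduced_ratio_inj (x y x' y' z w z' w' : int) :
  0 < y -> 0 < y' -> x * w - y * z \in GRing.unit ->
  x' * w' - y' * z' \in GRing.unit ->
  x%:~R / y%:~R = x'%:~R / y'%:~R :> rat -> x = x' /\ y = y'.
Proof.
have cop (m n r s : int) : m * s - n * r \in GRing.unit -> coprime `|m| `|n|.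
  move=> U; rewrite -/(coprimez m n); apply/coprimezP.
  case/unitrP: U => t [tE _].
  by exists (t * s, - (t * r)) => /=; rewrite -tE; ring.
move=> y0 y0' /cop c1 /cop c2 E.
have := coprimeq_den c1; have := coprimeq_den c2.
have := coprimeq_num c1; have := coprimeq_num c2; rewrite -E.
rewrite !gt_eqF // !gtr0_sg // !mul1r !gtr0_norm // => -> -> -> ->.
by [].
Qed.

(** The comparison of the two columns must be carried through the induction on
both coordinates at once; it starts from the column (z, 1) against (1, 0),
where a last entry z > 1 makes it strict. *)
Lemma cfcol_lt (q : seq int) :
  q != [::] -> all (fun z => 1 <= z) q -> 1 < last 0 q ->
  [/\ 0 <= (cfcol q (0, 1)).1, (cfcol q (0, 1)).1 < (cfcol q (1, 0)).1,
      0 <= (cfcol q (0, 1)).2 & (cfcol q (0, 1)).2 < (cfcol q (1, 0)).2].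
Proof.
elim: q => [//|z [|w q] IH] _ /andP[z1 qa] ql; first by move: ql => /= ql; split; lia.
have [//|//|//|] := IH.
rewrite !(cfcol_cons z).
move: (cfcol _ _) (cfcol _ _) => [x0 y0] [x y] /= *; split=> //; nia.
Qed.

Lemma cfcol_short_lt (q : seq int) : q != [::] -> is_short q ->
  0 <= (cfcol q (0, 1)).2 < (cfcol q (1, 0)).2.
Proof.
case: q => [//|z [//|w q]] _; rewrite is_shortE => /andP[qa ql].
by have [//|//|//| /= -> ->] := @cfcol_lt (w :: q).
Qed.

(** Taking the reciprocal of d/b = [p] puts a 0 in front of p, or removes a
leading 0.  The even length of p puts its last entry among the multiples of v,
so that it exceeds 1 and the resulting sequence is short. *)
Lemma alternates_C_of_cfcol (u v : nat) (b d : int) (p : seq int) :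
  (1 < v)%N -> ~~ odd (size p) -> alternates v u p ->
  0 <= head 0 p -> all (fun z => 1 <= z) (behead p) ->
  cfcol p (1, 0) = (d, b) -> alternates u v (C (b%:~R / d%:~R)).
Proof.
move=> v1; case: p => [|z [//|w p]].
  (* Here d/b is 1/0, while b/d = 0 = [0]. *)
  move=> _ _ _ _ [<- <-]; rewrite mul0r (@C_eq _ [:: 0]) ?/short_cfrac_of ?is_shortE //.
  by rewrite /= dvdz0.
rewrite [odd _]/= negbK -[head _ _]/z -[behead _]/(w :: p).
rewrite -[alternates v u _]/((u%:Z %| z)%Z && alternates u v (w :: p)).
move=> /negbTE pe /andP[uz alt] z0 pa pE.
have ql : 1 < last 0 (w :: p).
  have := pa; have := alt; rewrite (lastI w p) all_rcons alternates_rcons.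
  rewrite size_belast pe last_rcons => /andP[_ /dvdzP[m ->]] /andP[mv _].
  have m0 : 0 < m by nia.
  nia.
have ws : is_short (w :: p).
  by rewrite is_shortE ql implybT andbT; case/andP: pa.
have [_ E] := @cfrac_cfcol (w :: p) isT ws.
have [zE|zN0] := eqVneq z 0.
  move: pE; rewrite zE cfcol_cons mul0r add0r => -[<- <-].
  by rewrite (@C_eq _ (w :: p)) // /short_cfrac_of ws E eqxx.
have zs : is_short [:: 0, z, w & p].
  have z1 : 1 <= z by lia.
  rewrite is_shortE -[all _ (behead _)]/((1 <= z) && all _ (w :: p)) z1 pa.
  by rewrite [last _ _]/(last 0 (w :: p)) ql implybT.
rewrite (@C_eq _ [:: 0, z, w & p]) /= ?dvdz0 ?uz //.
rewrite /short_cfrac_of zs; have [_ ->] := @cfrac_cfcol [:: 0, z, w & p] isT zs.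
by rewrite cfcol_cons pE mul0r add0r /= eqxx.
Qed.

(** The head of a short continued fraction is the floor of its value. *)
Lemma short_head_ge0 (x : rat) (q : seq int) :
  0 <= x -> short_cfrac_of x q -> 0 <= head 0 q.
Proof.
case: q => [//|z q] x0 /andP[qs /eqP qx].
have [q0|qN] := eqVneq q [::].
  by move: qx x0; rewrite q0 => /= -[<-]; rewrite ler0z.
have [_ [y _ [y1 E]]] := cfrac_cons qN qs.
move: x0; rewrite -ltzD1 -(ltr_int rat) (Some_inj (etrans (esym qx) E)) => x0.
by rewrite (le_lt_trans x0) // intrD ltrD2l invf_lt1 // (lt_trans _ y1).
Qed.

(** The first column of a matrix of determinant 1 determines the second up to a
multiple k of the first; congruence and positivity force k to be a legitimate
additional partial quotient, or 0. *)
Lemma alternates_C_second_column (u v : nat) (a b c d : int) :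
  (1 < v)%N -> 0 < a -> 0 <= b -> 0 <= c -> (v %| a - 1)%Z -> (v %| b)%Z ->
  a * d - b * c = 1 ->
  alternates v u (C (c%:~R / a%:~R)) -> alternates u v (C (b%:~R / d%:~R)).
Proof.
move=> v1 a0 b_ge0 c_ge0 va vb dM.
move: (C_short (c%:~R / a%:~R)); move: (C (c%:~R / a%:~R)) => q qC alt.
have /andP[qs /eqP qE] := qC.
have qN : q != [::] by case: (q) qE.
have [y0] := cfrac_cfcol _ qN qs; rewrite qE => /Some_inj rE.
have /= qdet := cfcol_det q (1, 0) (0, 1).
rewrite mulr0 subr0 !mulr1 in qdet.
have [q1 q2] : c = (cfcol q (1, 0)).1 /\ a = (cfcol q (1, 0)).2.
  apply: (@reduced_ratio_inj _ _ _ _ d b (cfcol q (0, 1)).1 (cfcol q (0, 1)).2) => //.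
    by rewrite [X in X \is a _](_ : _ = -1) ?unitrN1 //; lia.
  by rewrite qdet unitrX // unitrN1.
have lin k := cfcol_linear q k 1 0 0 1.
have := cfcol_short_lt _ qN qs; have := cfcol_mod _ _ _ (1, 0) alt.
have := cfcol_mod _ _ _ (0, 1) alt.
move: lin qdet; rewrite -q1 -q2; case E0: (cfcol q (0, 1)) => [d0 b0] /= lin qdet.
have vN1 : ~~ (v%:Z %| 1)%Z by rewrite dvdz1 absz_nat; lia.
case so: (odd (size q)); last first.
  move=> _ /andP[_]; rewrite subr0 => va'.
  by have := rpredB va' va; rewrite (_ : a - (a - 1) = 1) ?(negPf vN1) //; ring.
rewrite subr0 => /andP[_ vb0] /andP[_ _] /andP[b0_ge0 b0_lt].
move: qdet; rewrite -signr_odd so expr1 => qdet.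
(* Solves (d, b) = k (c, a) + (d0, b0): take determinants against (d0, b0). *)
pose k := b * d0 - d * b0.
have bE : b = k * a + b0.
  apply/eqP; rewrite -subr_eq0.
  have -> : b - (k * a + b0) =
      b * (c * b0 - a * d0 + 1) + b0 * (a * d - b * c - 1) by rewrite /k; ring.
  by rewrite qdet dM addNr subrr !mulr0.
have dE : d = k * c + d0.
  apply/eqP; rewrite -subr_eq0.
  have -> : d - (k * c + d0) =
      d * (c * b0 - a * d0 + 1) + d0 * (a * d - b * c - 1) by rewrite /k; ring.
  by rewrite qdet dM addNr subrr !mulr0.
clearbody k.
have vk : (v %| k)%Z.
  have -> : k = b - b0 - k * (a - 1) by rewrite {1}bE; ring.
  by rewrite !rpredB // dvdz_mull.
(* (k + 1) a = b + (a - b0) is positive. *)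
have k_ge0 : 0 <= k.
  rewrite -ltzD1 -(pmulr_lgt0 _ a0) mulrDl mul1r.
  by rewrite -(ltrD2r b0) add0r addrAC -bE ltr_wpDl.
have head_ge0 : 0 <= head 0 q.
  by apply: short_head_ge0 qC; rewrite divr_ge0 ?ler0z // ltW.
have tail_ge1 : all (fun z => 1 <= z) (behead q).
  by move: qs; rewrite is_shortE => /andP[].
have [k0|kN0] := eqVneq k 0.
  (* K of the one-entry sequence l sends (0, 1) to (1, 0): the previous
     convergent is the value of q without its last entry. *)
  have [p [l pE]] : exists p l, q = rcons p l.
    by case/lastP: (q) qN => [//|p l] _; exists p, l.
  move: alt so E0 head_ge0 tail_ge1; rewrite pE alternates_rcons size_rcons.
  rewrite cfcol_rcons /= mulr0 add0r => /andP[alt _] so E0.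
  have [-> ->] : b = b0 /\ d = d0 by rewrite bE dE k0 !mul0r !add0r.
  move=> h t; apply: (@alternates_C_of_cfcol _ _ _ _ p) => //.
    by case: (p) h.
  by case: (p) t => //= x p'; rewrite all_rcons => /andP[].
apply: (@alternates_C_of_cfcol _ _ _ _ (rcons q k)) => //.
- by rewrite size_rcons /= so.
- by rewrite alternates_rcons alt so.
- by case: (q) qN head_ge0.
- case: (q) qN tail_ge1 => //= x q' _; rewrite all_rcons => ->.
  by rewrite andbT -gtz0_ge1 lt_def kN0 k_ge0.
rewrite cfcol_rcons /=.
have := lin k; rewrite /= !mulr1 !mulr0 !addr0 add0r => ->.
by rewrite -dE -bE.
Qed.

Theorem proposition3 (u v : nat) (hu : (2 <= u)%N) (hv : (2 <= v)%N)
    (a b c d : nat) (hM : scrS u v (mx2 a b c d)) :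
  divisibility_property v u (C (c%:R / a%:R)) <->
  divisibility_property u v (C (b%:R / d%:R)).
Proof.
rewrite !divisibility_propertyE.
case: hM; rewrite /SL2N (expand_det_row _ 0) !big_ord_recl big_ord0 /cofactor !det_mx11 !mxE /=.
move=> detM [n1 [n2 [n3 [n4]]]] /matrixP E.
have {}detM : a%:Z * d%:Z - b%:Z * c%:Z = 1 by rewrite -detM; ring.
have := E 0 0; have := E 0 1; have := E 1 0; have := E 1 1.
rewrite !mxE /= => dE cE bE aE {E}.
have a0 : 0 < a%:Z by rewrite aE; lia.
have d0 : 0 < d%:Z by rewrite dE; lia.
split.
  apply: (@alternates_C_second_column u v a b c d) => //.
    by rewrite aE PoszD addrC addKr -mulnA mulnCA PoszM dvdz_mulr.
  by rewrite bE PoszM dvdz_mulr.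
apply: (@alternates_C_second_column v u d c b a) => //.
- by rewrite dE PoszD addrC addKr -mulnA PoszM dvdz_mulr.
- by rewrite cE PoszM dvdz_mulr.
by rewrite -detM; ring.
Qed.
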